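(* Let $\mathfrak s=\mathbb R b\oplus\tilde{\mathfrak s}$ be the $(n+1)$-dimensional Lie algebra ($n\ge 2$) that extends the abelian Lie algebra $\tilde{\mathfrak s}$ by a symmetric operator $L$ with eigenvalues $\mu_1\le\mu_2\le\dots\le\mu_n$, all different from zero, and let $e_0=b,e_1,\dots,e_n$ be an orthonormal basis of $\mathfrak s$ with $Le_i=\mu_ie_i$ for $i\ge 1$. Suppose the Weyl connection defined by a left invariant vector field $E=\sum_{i=0}^n\alpha_ie_i\in\mathfrak s$ is non-positive. Then $\alpha_0\notin(\mu_1,\mu_n)$. If further $\mu_n>0$ and $\alpha_0\ge\mu_n$, then all of the positive eigenvalues of $L$ are equal to $\mu_n$, and $E=\mu_ne_0$. Likewise, if further $\mu_1<0$ and $\alpha_0\le\mu_1$, then all of the negative eigenvalues of $L$ are equal to $\mu_1$, and $E=\mu_1e_0$.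
   Context: Setting. $\tilde{\mathfrak s}$ is an abelian Lie algebra of dimension $n$, $L:\tilde{\mathfrak s}\to\tilde{\mathfrak s}$ is linear, and $\mathfrak s=\mathbb R b\oplus\tilde{\mathfrak s}$ has bracket $[b,u]=Lu$ and $[u,v]=0$ for $u,v\in\tilde{\mathfrak s}$. $\mathfrak s$ has a scalar product $\langle\cdot,\cdot\rangle$ in which $b$ is a unit vector orthogonal to $\tilde{\mathfrak s}$, and $L$ is symmetric with respect to it. A Lie group $S$ with Lie algebra $\mathfrak s$ carries the corresponding left invariant metric, and elements of $\mathfrak s$ are viewed as left invariant vector fields on $S$. The eigenvalues of $L$ meant are those of $L$ on $\tilde{\mathfrak s}$. Weyl connections. On a Riemannian manifold with metric $\langle\cdot,\cdot\rangle$, Levi-Civita connection $\nabla$ and sectional curvature $K$, for a vector field $E$ let $\varphi=\langle E,\cdot\rangle$. The Weyl connection defined by $E$ is $\widehat\nabla_XY=\nabla_XY+\varphi(Y)X+\varphi(X)Y-\langle X,Y\rangle E$. Let $\widehat R(X,Y)=\widehat\nabla_X\widehat\nabla_Y-\widehat\nabla_Y\widehat\nabla_X-\widehat\nabla_{[X,Y]}$ and $\widehat R_a(X,Y)=\widehat R(X,Y)-d\varphi(X,Y)I$ its anti-symmetric part. For a tangent plane $\Pi$ with orthonormal basis $\{X,Y\}$ put $\widehat K(\Pi)=\langle\widehat R_a(X,Y)Y,X\rangle$; equivalently $\widehat K(\Pi)=K(\Pi)-|E_\perp|^2-\langle\nabla_XE,X\rangle-\langle\nabla_YE,Y\rangle$,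 where $E_\perp$ is the component of $E$ orthogonal to $\Pi$. The Weyl connection is non-positive if $\widehat K(\Pi)\le 0$ for every tangent plane $\Pi$ at every point. *)

(* Defs.v *)
From HB Require Import structures.
From mathcomp Require Import all_boot all_order all_algebra.
From mathcomp Require Import all_classical all_reals all_analysis.
Import Order.TTheory GRing.Theory Num.Theory.
Import numFieldNormedType.Exports.

Set Implicit Arguments.
Unset Strict Implicit.
Unset Printing Implicit Defensive.

Local Open Scope classical_set_scope.
Local Open Scope ring_scope.

Fixpoint Ck (R : realType) (V W : normedModType R) (k : nat) (U : set V)
    (f : V -> W) : Prop :=
  match k with
  | 0 => forall x, U x -> {for x, continuous f}
  | k'.+1 => (forall x, U x -> differentiable f x) /\
             (forall v : V, Ck k' U (fun x => 'd f x v))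
  end.

Definition smooth_on (R : realType) (V W : normedModType R) (U : set V)
    (f : V -> W) : Prop := forall k, Ck k U f.

(* [cmap] and [cinv] are total; only their restrictions to [cdom] and [cim]
   are meaningful. *)
Record chart (R : realType) (m : nat) (M : topologicalType) := Chart {
  cdom : set M;
  cmap : M -> 'rV[R]_m;
  cinv : 'rV[R]_m -> M;
  _ : open cdom;
  _ : open (cmap @` cdom);
  _ : forall p, cdom p -> cinv (cmap p) = p;
  _ : forall p, cdom p -> {for p, continuous cmap};
  _ : forall y, (cmap @` cdom) y -> {for y, continuous cinv}
}.

Definition cim (R : realType) (m : nat) (M : topologicalType)
    (c : chart R m M) : set 'rV[R]_m := cmap c @` cdom c.

(* The family [chart_at] plays the role of the atlas. *)
Record manifold (R : realType) (m : nat) := Manifold {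
  mcarrier :> topologicalType;
  chart_at : mcarrier -> chart R m mcarrier;
  _ : hausdorff_space mcarrier;
  _ : @second_countable mcarrier;
  _ : forall p, cdom (chart_at p) p;
  _ : forall p q : mcarrier,
        smooth_on (cmap (chart_at q) @` (cdom (chart_at p) `&` cdom (chart_at q)))
                  (cmap (chart_at p) \o cinv (chart_at q))
}.

(* The tangent space at [p] is 'rV[R]_m: a tangent vector is given by its
   components in the chart [chart_at p]. *)
Definition vfield (R : realType) (m : nat) (M : manifold R m) :=
  M -> 'rV[R]_m.

Section Calculus.
Context (R : realType) (m : nat) (M : manifold R m).
Implicit Types (p q : M) (f : M -> R) (X Y Z E : vfield M).

Definition smooth_fun f : Prop :=
  forall p, smooth_on (cim (chart_at p)) (f \o cinv (chart_at p)).

(* The derivative X f. *)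
Definition vder X f : M -> R := fun p =>
  'd (f \o cinv (chart_at p)) (cmap (chart_at p) p) (X p).

Definition tangent_map (F : M -> M) p (v : 'rV[R]_m) : 'rV[R]_m :=
  'd (cmap (chart_at (F p)) \o F \o cinv (chart_at p)) (cmap (chart_at p) p) v.

(* The components, in the chart [chart_at p], of the vector field X. *)
Definition vrep X p : 'rV[R]_m -> 'rV[R]_m := fun y =>
  let q := cinv (chart_at p) y in
  'd (cmap (chart_at p) \o cinv (chart_at q)) (cmap (chart_at q) q) (X q).

Definition smooth_vf X : Prop :=
  forall p, smooth_on (cim (chart_at p)) (vrep X p).

(* [X, Y] = XY - YX, computed in the chart [chart_at p]. *)
Definition lie X Y : vfield M := fun p =>
  'd (vrep Y p) (cmap (chart_at p) p) (X p) -
  'd (vrep X p) (cmap (chart_at p) p) (Y p).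

Definition inner (g : M -> 'rV[R]_m -> 'rV[R]_m -> R) X Y : M -> R :=
  fun p => g p (X p) (Y p).

Definition riemannian_metric (g : M -> 'rV[R]_m -> 'rV[R]_m -> R) : Prop :=
  [/\ forall p u v, g p u v = g p v u,
      forall p (a : R) u v w, g p (a *: u + v) w = a * g p u w + g p v w,
      forall p u, u != 0 -> 0 < g p u u &
      forall X Y, smooth_vf X -> smooth_vf Y -> smooth_fun (inner g X Y)].

Definition affine_connection (nabla : vfield M -> vfield M -> vfield M) : Prop :=
  [/\ forall X Y, smooth_vf X -> smooth_vf Y -> smooth_vf (nabla X Y),
      forall f X X' Y, smooth_fun f -> smooth_vf X -> smooth_vf X' ->
        smooth_vf Y -> forall p,
        nabla (fun q => f q *: X q + X' q) Y p =
        f p *: nabla X Y p + nabla X' Y p,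
      forall X Y Y', smooth_vf X -> smooth_vf Y -> smooth_vf Y' -> forall p,
        nabla X (fun q => Y q + Y' q) p = nabla X Y p + nabla X Y' p &
      forall f X Y, smooth_fun f -> smooth_vf X -> smooth_vf Y -> forall p,
        nabla X (fun q => f q *: Y q) p = vder X f p *: Y p + f p *: nabla X Y p].

Definition levi_civita (g : M -> 'rV[R]_m -> 'rV[R]_m -> R)
    (nabla : vfield M -> vfield M -> vfield M) : Prop :=
  [/\ affine_connection nabla,
      forall X Y, smooth_vf X -> smooth_vf Y -> forall p,
        nabla X Y p - nabla Y X p = lie X Y p &
      forall X Y Z, smooth_vf X -> smooth_vf Y -> smooth_vf Z -> forall p,
        vder X (inner g Y Z) p =
        inner g (nabla X Y) Z p + inner g Y (nabla X Z) p].

Definition weyl_connection (g : M -> 'rV[R]_m -> 'rV[R]_m -> R)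
    (nabla : vfield M -> vfield M -> vfield M) E X Y : vfield M := fun p =>
  nabla X Y p + inner g E Y p *: X p + inner g E X p *: Y p
  - inner g X Y p *: E p.

Definition curvature (nabla : vfield M -> vfield M -> vfield M) X Y Z :
    vfield M := fun p =>
  nabla X (nabla Y Z) p - nabla Y (nabla X Z) p - nabla (lie X Y) Z p.

Definition ext_der (phi : vfield M -> M -> R) X Y : M -> R := fun p =>
  vder X (phi Y) p - vder Y (phi X) p - phi (lie X Y) p.

Definition weyl_curvature_anti (g : M -> 'rV[R]_m -> 'rV[R]_m -> R)
    (nabla : vfield M -> vfield M -> vfield M) E X Y Z : vfield M := fun p =>
  curvature (weyl_connection g nabla E) X Y Z p -
  ext_der (inner g E) X Y p *: Z p.

Definition weyl_sectional (g : M -> 'rV[R]_m -> 'rV[R]_m -> R)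
    (nabla : vfield M -> vfield M -> vfield M) E X Y : M -> R :=
  inner g (weyl_curvature_anti g nabla E X Y Y) X.

(* A tangent plane at p is given by an orthonormal basis (X p, Y p); by
   tensoriality its curvature depends on X and Y only through this plane. *)
Definition weyl_nonpositive (g : M -> 'rV[R]_m -> 'rV[R]_m -> R)
    (nabla : vfield M -> vfield M -> vfield M) E : Prop :=
  forall p X Y, smooth_vf X -> smooth_vf Y ->
    inner g X X p = 1 -> inner g Y Y p = 1 -> inner g X Y p = 0 ->
    weyl_sectional g nabla E X Y p <= 0.

End Calculus.

Record lie_group (R : realType) (m : nat) := LieGroup {
  lg_manifold :> manifold R m;
  lg_mul : lg_manifold -> lg_manifold -> lg_manifold;
  lg_one : lg_manifold;
  lg_inv : lg_manifold -> lg_manifold;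
  _ : associative lg_mul;
  _ : left_id lg_one lg_mul;
  _ : left_inverse lg_one lg_inv lg_mul;
  _ : continuous (fun z : lg_manifold * lg_manifold => lg_mul z.1 z.2);
  _ : continuous lg_inv;
  _ : forall a b c : lg_manifold,
        smooth_on
          [set z : 'rV[R]_m * 'rV[R]_m |
            [/\ cim (chart_at a) z.1, cim (chart_at b) z.2 &
                cdom (chart_at c)
                  (lg_mul (cinv (chart_at a) z.1) (cinv (chart_at b) z.2))]]
          (fun z : 'rV[R]_m * 'rV[R]_m =>
            cmap (chart_at c)
              (lg_mul (cinv (chart_at a) z.1) (cinv (chart_at b) z.2)));
  _ : forall a c : lg_manifold,
        smooth_on
          [set y | cim (chart_at a) y /\
                   cdom (chart_at c) (lg_inv (cinv (chart_at a) y))]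
          (fun y => cmap (chart_at c) (lg_inv (cinv (chart_at a) y)))
}.

Definition left_invariant (R : realType) (m : nat) (S : lie_group R m)
    (X : vfield S) : Prop :=
  forall a q : S, tangent_map (lg_mul a) q (X q) = X (lg_mul a q).

(* [iota] is an isomorphism from the Lie algebra (s, br) onto the Lie algebra
   of smooth left invariant vector fields of S. *)
Definition lie_algebra_of (R : realType) (m : nat) (S : lie_group R m)
    (s : lmodType R) (br : s -> s -> s) (iota : s -> vfield S) : Prop :=
  [/\ forall (a : R) u v p, iota (a *: u + v) p = a *: iota u p + iota v p,
      injective iota,
      forall u, smooth_vf (iota u) /\ left_invariant (iota u),
      forall X : vfield S, smooth_vf X -> left_invariant X ->
        exists u, iota u = X &
      forall u v p, iota (br u v) p = lie (iota u) (iota v) p].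

Definition scalar_product (R : realType) (V : lmodType R)
    (ip : V -> V -> R) : Prop :=
  [/\ forall u v, ip u v = ip v u,
      forall (a : R) u v w, ip (a *: u + v) w = a * ip u w + ip v w &
      forall u, u != 0 -> 0 < ip u u].

(* The extension R b (+) t of the abelian Lie algebra t by the operator L. *)
Section Extension.
Context (R : realType) (t : vectType R).

Definition ext : vectType R := (R^o * t)%type.

Definition ext_b : ext := (1, 0).

Definition ext_bracket (L : 'End(t)) (x y : ext) : ext :=
  (0, x.1 *: L y.2 - y.1 *: L x.2).

(* Extends the scalar product of t, with b a unit vector orthogonal to t. *)
Definition ext_ip (ip : t -> t -> R) (x y : ext) : R :=
  x.1 * y.1 + ip x.2 y.2.

End Extension.

(* Main.v *)
Require Import Defs.
From HB Require Import structures.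
From mathcomp Require Import all_boot all_order all_algebra.
From mathcomp Require Import all_classical all_reals all_analysis.
From mathcomp Require Import ring lra.
Import Order.TTheory GRing.Theory Num.Theory.
Import numFieldNormedType.Exports.
Local Open Scope ring_scope.

(** Left invariant fields reduce the theorem to algebra.  For them every inner
product is constant, so the Koszul formula expresses the Levi-Civita
connection by brackets: [nabla_x y] is again left invariant, with [b]-component
[<L u, v>] and remaining component [- c L u] if [x = a b + u] and
[y = c b + v] ([ext_lc], [nabla_iota]).  The Weyl connection and its curvature
are then polynomial in the components, and non-positivity says that
[weyl_form] is non-positive on all pairs of orthogonal vectors [x = a b + u]
and [v], with [v] in the abelian ideal ([weyl_form_nonpos_of_weyl]).  Only such
planes are used below.

Write [E = al b + w], [M = L - al] and, for a unit eigenvector [f] of [L] with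
eigenvalue [m], [w' = w - <w, f> f].

The key fact is that [L w = al w] with [al <> 0] forces [w = 0]
([eigenvector_component_eq0]).  In the plane of [b + c w] and a vector [v]
orthogonal to [w], the unnormalized curvature is affine in [c] with slope
[al |v|^2 |w|^2], because the terms quadratic in [c] cancel; it can stay
non-positive for all [c] only if [w = 0].  A suitable [v] exists since the
ideal has dimension at least 2.

Let [m_1 < al < m_n].  The planes of [w'] and [f] for the two extreme
eigenvectors bound [<M w, w>] from above and from below by 0
([eigenplane_form_ge]), so [M w] is orthogonal to [w]; the curvature of the
plane of [w] and [M w] is then [|M w|^4] up to normalization, hence [M w = 0].
So [w = 0], by the key fact or, for [al = 0], because [L] is injective.
With [w = 0] the plane of the two eigenvectors has curvature
[- (m_1 - al) (m_n - al) > 0], a contradiction.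

Let [al >= m_n > 0].  The plane of [al b + w'] and [f] gives
[m (al^2 (al - m) - <M w', w'>) <= 0] for every eigenvalue [m]
([base_eigenplane_form]).  For [m = m_n] both terms are non-negative, so
[al = m_n] and [w'] maximizes the Rayleigh quotient of [L], whence [M w = 0] and
again [w = 0].  With [w = 0] the same inequality for any positive [m] reads
[al <= m].  The last assertion is the previous one for [- L] and [- al]: the
form is unchanged when [b] is replaced by [- b]. *)

Set Implicit Arguments.
Unset Strict Implicit.
Unset Printing Implicit Defensive.

(** * Scalar products and symmetric operators *)

Section ScalarProduct.
Context (R : realType) (V : lmodType R) (ip : V -> V -> R).
Context (hip : scalar_product ip).
Implicit Types (a : R) (u v w : V).

Lemma ipC u v : ip u v = ip v u. Proof. by case: hip. Qed.

Lemma ipDl u v w : ip (u + v) w = ip u w + ip v w.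
Proof. by case: hip => _ h _; rewrite -[u]scale1r h scale1r mul1r. Qed.

Lemma ip0l w : ip 0 w = 0.
Proof. by have := ipDl 0 0 w; rewrite addr0 => h; lra. Qed.

Lemma ipZl a u w : ip (a *: u) w = a * ip u w.
Proof. by case: hip => _ h _; rewrite -[a *: u]addr0 h ip0l addr0. Qed.

Lemma ipNl u w : ip (- u) w = - ip u w.
Proof. by rewrite -scaleN1r ipZl mulN1r. Qed.

Lemma ipDr u v w : ip w (u + v) = ip w u + ip w v.
Proof. by rewrite ipC ipDl !(ipC w). Qed.

Lemma ip0r w : ip w 0 = 0. Proof. by rewrite ipC ip0l. Qed.

Lemma ipZr a u w : ip w (a *: u) = a * ip w u.
Proof. by rewrite ipC ipZl ipC. Qed.

Lemma ipNr u w : ip w (- u) = - ip w u.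
Proof. by rewrite ipC ipNl ipC. Qed.

Definition ipE := (ipDl, ipDr, ipZl, ipZr, ipNl, ipNr, ip0l, ip0r).

Lemma ip_suml (I : Type) (r : seq I) (P : pred I) (F : I -> V) w :
  ip (\sum_(i <- r | P i) F i) w = \sum_(i <- r | P i) ip (F i) w.
Proof.
exact: (big_morph (fun u => ip u w) (fun u v => ipDl u v w) (ip0l w)).
Qed.

Lemma ip_gt0 u : u != 0 -> 0 < ip u u.
Proof. by case: hip => _ _; apply. Qed.

Lemma ip_eq0 u : (ip u u == 0) = (u == 0).
Proof.
have [->|u0] := eqVneq u 0; first by rewrite ip0l eqxx.
by apply/negbTE; rewrite gt_eqF // ip_gt0.
Qed.

Lemma ip_ge0 u : 0 <= ip u u.
Proof.
have [->|u0] := eqVneq u 0; first by rewrite ip0l.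
by apply: ltW; apply: ip_gt0.
Qed.

(** The functional [<w, .>] has a kernel in the plane of [f1] and [f2]. *)
Lemma exists_orthogonal (f1 f2 w : V) :
  ip f1 f1 = 1 -> ip f2 f2 = 1 -> ip f1 f2 = 0 ->
  exists2 v, v != 0 & ip w v = 0.
Proof.
move=> h1 h2 h12.
have [y0|y0] := eqVneq (ip w f2 *: f1 - ip w f1 *: f2) 0; last first.
  by exists (ip w f2 *: f1 - ip w f1 *: f2) => //; rewrite !ipE; ring.
exists f1.
  apply/eqP => f0; move: h1; rewrite f0 ip0l => /eqP.
  by rewrite eq_sym oner_eq0.
have /(congr1 (fun z => ip z f2)) := y0.
by rewrite !ipE h12 h2 => h; lra.
Qed.

End ScalarProduct.

Lemma lfunD_apply (K : fieldType) (U V : vectType K) (f : 'Hom(U, V)) u v :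
  f (u + v) = f u + f v.
Proof. exact: linearD. Qed.

Lemma lfunN_apply (K : fieldType) (U V : vectType K) (f : 'Hom(U, V)) u :
  f (- u) = - f u.
Proof. exact: linearN. Qed.

Lemma lfunZ_apply (K : fieldType) (U V : vectType K) (f : 'Hom(U, V)) a u :
  f (a *: u) = a *: f u.
Proof. exact: linearZ. Qed.

Definition lfunE_ops := (lfunD_apply, lfunN_apply, lfunZ_apply).

Section SymmetricOperator.
Context (R : realType) (t : vectType R) (ip : t -> t -> R) (L : 'End(t)).
Context (hip : scalar_product ip).
Context (hL : forall u v : t, ip (L u) v = ip u (L v)).

(** At a maximum [u] of the Rayleigh quotient, moving in the direction
[z = L u - m u] changes [<L v, v> - m <v, v>] at first order by [2 |z|^2],
so [z] vanishes. *)
Lemma rayleigh_max_eigen m u :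
  (forall v, ip (L v) v <= m * ip v v) -> ip (L u) u = m * ip u u ->
  L u = m *: u.
Proof.
move=> top eq_u; apply/eqP; rewrite -subr_eq0 -(ip_eq0 hip).
set z := L u - m *: u.
have Ez : L u = z + m *: u by rewrite subrK.
have uz : ip u z = 0 by rewrite !(ipE hip) (ipC hip u) eq_u; ring.
clearbody z.
pose k := 1 + (m * ip z z - ip (L z) z); have k1 : 1 <= k.
  by rewrite lerDl subr_ge0.
(* The step |z|^2 / k is short enough for the first order term to win. *)
have := top (u + (ip z z / k) *: z).
have -> : ip (L (u + (ip z z / k) *: z)) (u + (ip z z / k) *: z) =
   m * ip u u + 2 * (ip z z / k) * ip z z + (ip z z / k) ^+ 2 * ip (L z) z.
  rewrite lfunD_apply lfunZ_apply !(ipE hip) (hL z u) (ipC hip z (L u)) Ez.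
  by rewrite !(ipE hip) (ipC hip z u) uz; ring.
rewrite !(ipE hip) (ipC hip z u) uz => h.
set s := ip z z / k in h.
have Zs : ip z z = k * s by rewrite /s mulrC divfK // gt_eqF //; lra.
have s0 : s = 0.
  apply/eqP; rewrite -sqrf_eq0; apply/eqP.
  have := sqr_ge0 s; rewrite /k in k1 Zs; nra.
by rewrite Zs s0 mulr0.
Qed.

End SymmetricOperator.

Section Eigenbasis.
Context (R : realType) (t : vectType R) (ip : t -> t -> R).
Context (hip : scalar_product ip).
Context (n : nat) (f : nat -> t).
Context (f_orth : forall i j, (1 <= i <= n)%N -> (1 <= j <= n)%N ->
  ip (f i) (f j) = (i == j)%:R).
Context (f_total : forall u,
  (forall i, (1 <= i <= n)%N -> ip u (f i) = 0) -> u = 0).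

Lemma orthonormal_expansion u : u = \sum_(1 <= i < n.+1) ip u (f i) *: f i.
Proof.
apply/eqP; rewrite -subr_eq0; apply/eqP; apply: f_total => j j1.
rewrite (ipDl hip) (ipNl hip) (ip_suml hip).
rewrite (bigD1_seq j) ?iota_uniq //=; last first.
  by rewrite mem_index_iota.
rewrite (ipZl hip) f_orth // eqxx mulr1 big_seq_cond big1 ?addr0 ?subrr //.
move=> i /andP[]; rewrite mem_index_iota => i1 ij.
by rewrite (ipZl hip) f_orth // (negbTE ij) mulr0.
Qed.

Lemma rayleigh_le (L : 'End(t)) (mu : nat -> R) k :
  (forall u v, ip (L u) v = ip u (L v)) ->
  (forall i, (1 <= i <= n)%N -> L (f i) = mu i *: f i) ->
  (forall i, (1 <= i <= n)%N -> mu i <= k) ->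
  forall u, ip (L u) u <= k * ip u u.
Proof.
move=> hL Lf muk u.
have pairing v : ip v u = \sum_(1 <= i < n.+1) ip u (f i) * ip v (f i).
  rewrite {1}(orthonormal_expansion u) (ipC hip) (ip_suml hip).
  by apply: eq_bigr => i _; rewrite (ipZl hip) (ipC hip _ v).
rewrite !pairing mulr_sumr !big_seq; apply: ler_sum => i.
rewrite mem_index_iota => i1; rewrite hL Lf // (ipZr hip) mulrCA.
by apply: ler_wpM2r; rewrite ?muk // -expr2 sqr_ge0.
Qed.

End Eigenbasis.

(** * Non-positivity of the Weyl curvature form *)

Section WeylForm.
Context (R : realType) (t : vectType R) (ip : t -> t -> R).
Context (hip : scalar_product ip).

(** For [E = al b + w] this is the Weyl sectional curvature of the plane of
[x = a b + u] and [v], times [|x|^2 |v|^2], when [x] and [v] are orthogonal.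
The first line is the Riemannian part, the second and third are
[- |x|^2 |v|^2 |E_perp|^2], and the last two come from [<nabla_x E, x>]
and [<nabla_v E, v>].  Leaving the vectors unnormalized makes it polynomial. *)
Definition weyl_form (L : 'End(t)) (al : R) (w : t) (a : R) (u v : t) : R :=
  - ip (L u) u * ip (L v) v + ip (L u) v ^+ 2 - a ^+ 2 * ip (L v) (L v)
  - ((a ^+ 2 + ip u u) * ip v v * (al ^+ 2 + ip w w)
     - ip v v * (a * al + ip u w) ^+ 2 - (a ^+ 2 + ip u u) * ip v w ^+ 2)
  - ip v v * (a * ip (L u) w - al * ip (L u) u)
  + (a ^+ 2 + ip u u) * (al * ip (L v) v).

Definition weyl_form_nonpos (L : 'End(t)) (al : R) (w : t) : Prop :=
  forall a u v, ip u v = 0 -> weyl_form L al w a u v <= 0.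

(** Passing from [b] to [- b] turns [L], [al], [a] into their opposites. *)
Lemma weyl_form_nonposN L al w :
  weyl_form_nonpos L al w -> weyl_form_nonpos (- L) (- al) w.
Proof.
move=> h a u v /(h (- a)); rewrite /weyl_form !opp_lfunE !(ipE hip).
by apply: le_trans; rewrite le_eqVlt; apply/orP; left; apply/eqP; ring.
Qed.

Context (L : 'End(t)) (al : R) (w : t).
Context (hL : forall u v : t, ip (L u) v = ip u (L v)).
Context (hK : weyl_form_nonpos L al w).

(** On the plane of [b + c w] and [v] the part of the form that is quadratic in
[c] cancels, and what is left is affine in [c] with slope [al |v|^2 |w|^2]; it
is bounded above only if that slope is 0. *)
Lemma eigenvector_component_eq0 v :
  al != 0 -> L w = al *: w -> v != 0 -> ip w v = 0 -> w = 0.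
Proof.
move=> al0 Lw v0 wv; apply/eqP; rewrite -(ip_eq0 hip); apply/negPn/negP => W0.
have V0 : ip v v != 0 by rewrite (ip_eq0 hip).
pose A := al * ip (L v) v - ip (L v) (L v).
(* The value of c at which the affine function of c equals 1. *)
pose c := (1 + (1 - A) / (ip v v * ip w w)) / al.
have /(hK 1) : ip (c *: w) v = 0 by rewrite !(ipE hip) wv mulr0.
rewrite /weyl_form !lfunE_ops Lw !(ipE hip) (ipC hip v w) wv.
set X := (X in X <= 0 -> _).
have -> : X = A + ip v v * ip w w * (al * c - 1) by rewrite /X /A; ring.
have -> : A + ip v v * ip w w * (al * c - 1) = 1.
  by rewrite /c; field; rewrite al0 W0 V0.
by rewrite ler10.
Qed.

(** The plane of [w' = w - <w, f> f] and [f] contains [w], so [E_perp = al b]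
there and the form is [- (m - al) <(L - al) w', w'>]. *)
Lemma eigenplane_form_ge m f :
  ip f f = 1 -> L f = m *: f ->
  (m - al) ^+ 2 * ip w f ^+ 2 <= (m - al) * (ip (L w) w - al * ip w w).
Proof.
move=> ff Lf.
have /(hK 0) : ip (w - ip w f *: f) f = 0 by rewrite !(ipE hip) ff; ring.
have Lwf : ip (L w) f = m * ip w f by rewrite hL Lf (ipZr hip).
rewrite /weyl_form !lfunE_ops Lf.
rewrite !(ipE hip) (ipC hip f w) ff Lwf => h.
by nra.
Qed.

(** The plane of [al b + w'] and [f] contains [E], so [E_perp = 0] there. *)
Lemma base_eigenplane_form m f :
  ip f f = 1 -> L f = m *: f ->
  let w' := w - ip w f *: f in
  m * (al * (al ^+ 2 + ip w' w') - al ^+ 2 * m - ip (L w') w') <= 0.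
Proof.
move=> ff Lf /=; set w' := w - _.
have fw' : ip w' f = 0 by rewrite !(ipE hip) ff; ring.
have Lw'f : ip (L w') f = 0 by rewrite hL Lf (ipZr hip) fw' mulr0.
have Ew : w = w' + ip w f *: f by rewrite subrK.
have := hK al fw'; rewrite /weyl_form Lf; clearbody w'.
set b := ip w f in Ew *; rewrite Ew !(ipE hip) (ipC hip f w') fw' Lw'f ff.
apply: le_trans; rewrite le_eqVlt; apply/orP; left; apply/eqP; ring.
Qed.

(** The two eigenplanes through [w] make [(L - al) w] orthogonal to [w]; the
plane of these two vectors then shows that [(L - al) w = 0], hence [w = 0], and
the plane of [f1] and [f2] has positive curvature.  Injectivity of [L] settles
[al = 0], which [eigenvector_component_eq0] leaves open. *)
Lemma between_eigenvalues_false m1 m2 f1 f2 :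
  (forall u, L u = 0 -> u = 0) ->
  ip f1 f1 = 1 -> ip f2 f2 = 1 -> ip f1 f2 = 0 ->
  L f1 = m1 *: f1 -> L f2 = m2 *: f2 ->
  m1 < al -> al < m2 -> False.
Proof.
move=> Linj f11 f22 f12 Lf1 Lf2 m1al alm2.
have q0 : ip (L w) w = al * ip w w.
  have := eigenplane_form_ge f11 Lf1; have := eigenplane_form_ge f22 Lf2.
  set q := ip (L w) w - _ => h2 h1; apply/eqP; rewrite -subr_eq0 -/q.
  rewrite eq_le; apply/andP; split.
    rewrite -(nmulr_rge0 _ (_ : m1 - al < 0)) ?subr_lt0 //.
    by apply: le_trans h1; rewrite mulr_ge0 ?sqr_ge0.
  rewrite -(pmulr_rge0 _ (_ : 0 < m2 - al)) ?subr_gt0 //.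
  by apply: le_trans h2; rewrite mulr_ge0 ?sqr_ge0.
have Lw : L w = al *: w.
  apply/eqP; rewrite -subr_eq0; set z := L w - al *: w.
  have wz : ip w z = 0 by rewrite !(ipE hip) (ipC hip w) q0; ring.
  have Ez : L w = z + al *: w by rewrite subrK.
  clearbody z; have := hK 0 wz.
  rewrite /weyl_form Ez !(ipE hip) (ipC hip z w) wz => h.
  by rewrite -(ip_eq0 hip); apply/eqP; have := ip_ge0 hip z; nra.
have w0 : w = 0.
  have [al0|al0] := eqVneq al 0; first by apply: Linj; rewrite Lw al0 scale0r.
  have [v v0 wv] := exists_orthogonal hip w f11 f22 f12.
  exact: eigenvector_component_eq0 al0 Lw v0 wv.
have := hK 0 f12; rewrite /weyl_form Lf1 Lf2 w0 !(ipE hip) f11 f22 f12 => h.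
by nra.
Qed.

(** In [base_eigenplane_form] for [f] both summands of the form are non-negative,
hence zero: the first gives [al = m], the second makes [w] satisfy
[L w = al w]. *)
Lemma ge_top_eigenvalue m f f' :
  ip f f = 1 -> ip f' f' = 1 -> ip f f' = 0 ->
  L f = m *: f -> (forall u, ip (L u) u <= m * ip u u) -> 0 < m -> m <= al ->
  [/\ al = m, w = 0 &
      forall k h, ip h h = 1 -> L h = k *: h -> 0 < k -> k = m].
Proof.
move=> ff ff' fof' Lf top m0 mal.
have al0 : 0 < al by exact: lt_le_trans mal.
have := base_eigenplane_form ff Lf; set w' := w - _ => /=.
rewrite pmulr_rle0 // => K.
have W0 := ip_ge0 hip w'; have tw := top w'.
have alm : al = m.
  apply/eqP; rewrite eq_le mal andbT.
  rewrite -subr_le0 -(pmulr_rle0 _ (_ : 0 < al ^+ 2)) ?exprn_gt0 //.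
  by nra.
have Lw' : L w' = m *: w'.
  apply: (rayleigh_max_eigen hip hL top).
  by apply/eqP; rewrite eq_le tw -alm; nra.
have Lw : L w = al *: w.
  have Ew : w = w' + ip w f *: f by rewrite subrK.
  clearbody w'; set b := ip w f in Ew.
  by rewrite Ew !lfunE_ops Lw' Lf alm scalerDr !scalerA (mulrC m).
have w0 : w = 0.
  have [v v0 wv] := exists_orthogonal hip w ff ff' fof'.
  by apply: eigenvector_component_eq0 Lw v0 wv; rewrite gt_eqF.
split=> // k h hh Lh k0.
have := base_eigenplane_form hh Lh; rewrite w0 (ip0l hip) scale0r subr0.
rewrite /= !(ip0r hip) pmulr_rle0 // alm => Kk.
have := top h; rewrite Lh (ipZl hip) hh !mulr1 => km.
apply/eqP; rewrite eq_le km.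
rewrite -subr_le0 -(pmulr_rle0 _ (_ : 0 < m ^+ 2)) ?exprn_gt0 //.
by nra.
Qed.

End WeylForm.

(** * Curvature of left invariant vector fields *)

(** Exposes to the ring tactic the scaling of the first factor of [ext t]. *)
Lemma regular_scaleE (K : pzRingType) (a : K) (b : K^o) : a *: b = a * b.
Proof. by []. Qed.

Section LeftInvariantFields.
Context (R : realType) (n : nat) (t : vectType R).
Context (ip : t -> t -> R) (L : 'End(t)).
Context (hip : scalar_product ip).
Context (hL : forall u v : t, ip (L u) v = ip u (L v)).

Lemma ext_ip_scalar_product : scalar_product (ext_ip ip).
Proof.
split=> [x y|a x y z|x x0].
- by rewrite /ext_ip mulrC (ipC hip).
- by rewrite /ext_ip /= regular_scaleE !(ipE hip); ring.
have x1 := sqr_ge0 x.1; have x2 := ip_ge0 hip x.2.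
rewrite lt_neqAle /ext_ip -expr2 addr_ge0 // andbT eq_sym paddr_eq0 //.
rewrite sqrf_eq0 (ip_eq0 hip); apply: contra x0 => /andP[/eqP x10 /eqP x20].
by apply/eqP; case: x x10 x20 {x1 x2} => x1 x2 /= -> ->.
Qed.

Let hB := ext_ip_scalar_product.

(** The Levi-Civita connection on the Lie algebra, solved from the Koszul
formula for the bracket [ext_bracket L]. *)
Definition ext_lc (x y : ext t) : ext t := (ip (L x.2) y.2, - y.1 *: L x.2).

Definition ext_weyl (E x y : ext t) : ext t :=
  ext_lc x y + ext_ip ip E y *: x + ext_ip ip E x *: y - ext_ip ip x y *: E.

Lemma ext_lc_torsion_free x y : ext_lc x y - ext_lc y x = ext_bracket L x y.
Proof.
rewrite /ext_lc /ext_bracket; congr pair => /=.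
  by rewrite hL (ipC hip) subrr.
by rewrite !scaleNr opprK addrC.
Qed.

Lemma ext_lc_metric x y z :
  ext_ip ip (ext_lc x y) z + ext_ip ip y (ext_lc x z) = 0.
Proof.
by rewrite /ext_ip /ext_lc /= !(ipE hip) (ipC hip y.2); ring.
Qed.

Context (S : lie_group R n.+1) (iota : ext t -> vfield S).
Context (ht : (\dim {:t} = n)%N).
Context (hS : lie_algebra_of (ext_bracket L) iota).
Context (g : S -> 'rV[R]_n.+1 -> 'rV[R]_n.+1 -> R).
Context (hg : riemannian_metric g).
Context (hg_inv : forall (x y : ext t) (p : S),
  g p (iota x p) (iota y p) = ext_ip ip x y).
Context (nabla : vfield S -> vfield S -> vfield S).
Context (hnabla : levi_civita g nabla).

Let gs p : scalar_product (g p).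
Proof.
by case: hg => h1 h2 h3 _; split=> *; [exact: h1|exact: h2|exact: h3].
Qed.

Lemma iota_linear p : linear (fun x => iota x p).
Proof. by case: hS => h _ _ _ _ a x y; rewrite h. Qed.

Lemma iotaD x y p : iota (x + y) p = iota x p + iota y p.
Proof. by rewrite -[x in LHS]scale1r iota_linear scale1r. Qed.

Lemma iota0 p : iota 0 p = 0.
Proof. by apply: (addrI (iota 0 p)); rewrite -iotaD !addr0. Qed.

Lemma iotaZ a x p : iota (a *: x) p = a *: iota x p.
Proof. by rewrite -[a *: x]addr0 iota_linear iota0 addr0. Qed.

Lemma iotaN x p : iota (- x) p = - iota x p.
Proof. by rewrite -scaleN1r iotaZ scaleN1r. Qed.

Definition iotaE := (iotaD, iotaN, iotaZ).

Lemma iota_smooth x : smooth_vf (iota x).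
Proof. by case: hS => _ _ h _ _; case: (h x). Qed.

Lemma iota_lie x y : lie (iota x) (iota y) = iota (ext_bracket L x y).
Proof. by case: hS => _ _ _ _ h; apply/funext => p; rewrite h. Qed.

Lemma inner_iota x y : inner g (iota x) (iota y) = cst (ext_ip ip x y).
Proof. by apply/funext => p; rewrite /inner hg_inv. Qed.

Lemma vder_cst (X : vfield S) (k : R) p : vder X (cst k) p = 0.
Proof.
rewrite /vder (_ : cst k \o _ = cst k) //.
by have -> := diff_cst k (cmap (chart_at p) p).
Qed.

(** At each point [iota] is isometric, hence injective, between spaces of equal
dimension. *)
Lemma iota_span p (w : 'rV[R]_n.+1) : exists x, w = iota x p.
Proof.
pose f := GRing.isLinear.Build R (ext t) 'rV[R]_n.+1 _ (fun x => iota x p)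
  (iota_linear p).
pose F : {linear ext t -> 'rV[R]_n.+1} := HB.pack (fun x => iota x p) f.
have ker0 : lker (linfun F) == 0%VS.
  apply/lker0P => x y; rewrite !lfunE /= => xy.
  apply/eqP; rewrite -subr_eq0 -(ip_eq0 hB) -(hg_inv _ _ p).
  by rewrite iotaD iotaN xy subrr (ip0l (gs p)).
have full : limg (linfun F) = fullv.
  apply/eqP; rewrite eqEdim subvf /=.
  have := limg_ker_dim (linfun F) fullv.
  rewrite (eqP ker0) capv0 dimv0 add0n => ->.
  rewrite !dimvf; move: ht; rewrite dimvf => dt.
  by rewrite /dim /= mul1n -/(dim t) dt.
have : w \in limg (linfun F) by rewrite full memvf.
by case/memv_imgP => x _ ->; exists x; rewrite lfunE.
Qed.

(** Koszul: the difference [T] of the two connections, as a trilinear form, is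
symmetric in its first two arguments (no torsion) and antisymmetric in its last
two (metric), which only [T = 0] satisfies. *)
Lemma nabla_iota x y : nabla (iota x) (iota y) = iota (ext_lc x y).
Proof.
apply/funext => p.
pose T a b c :=
  g p (nabla (iota a) (iota b) p - iota (ext_lc a b) p) (iota c p).
case: hnabla => _ tors metric.
have Tsym a b c : T a b c = T b a c.
  have := tors _ _ (iota_smooth a) (iota_smooth b) p.
  rewrite iota_lie -ext_lc_torsion_free iotaD iotaN => /eqP.
  rewrite subr_eq => /eqP h.
  by rewrite /T h !(ipE (gs p)); ring.
have Tanti a b c : T a b c = - T a c b.
  have := metric _ _ _ (iota_smooth a) (iota_smooth b) (iota_smooth c) p.
  rewrite inner_iota vder_cst /T !(ipE (gs p)) !hg_inv /inner.
  rewrite (ipC (gs p) (iota b p)).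
  have := ext_lc_metric a b c; rewrite (ipC hB b).
  by move=> h1 h2; lra.
have T0 a b c : T a b c = 0.
  have h1 := Tsym a b c; have h2 := Tanti b a c; have h3 := Tsym b c a.
  have h4 := Tanti c b a; have h5 := Tsym c a b; have h6 := Tanti a c b.
  by lra.
have [z Ez] := iota_span p (nabla (iota x) (iota y) p - iota (ext_lc x y) p).
apply/eqP; rewrite -subr_eq0 -(ip_eq0 (gs p)) {2}Ez.
by apply/eqP; apply: T0.
Qed.

Lemma weyl_iota E x y :
  weyl_connection g nabla (iota E) (iota x) (iota y) = iota (ext_weyl E x y).
Proof.
apply/funext => p; rewrite /weyl_connection nabla_iota !inner_iota.
by rewrite /ext_weyl !iotaE.
Qed.

Lemma weyl_sectional_iota E x v p : ip x.2 v = 0 ->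
  weyl_sectional g nabla (iota E) (iota x) (iota (0, v)) p =
  weyl_form ip L E.1 E.2 x.1 x.2 v.
Proof.
move=> xv; rewrite /weyl_sectional /inner /weyl_curvature_anti /curvature.
rewrite !weyl_iota iota_lie !weyl_iota /ext_der !inner_iota !vder_cst iota_lie.
rewrite inner_iota /=.
rewrite !(ipE (gs p)) !hg_inv.
case: x xv => a u /= uv; case: E => al w.
rewrite /ext_weyl /ext_lc /ext_bracket /ext_ip /weyl_form /=.
rewrite !regular_scaleE !lfunE_ops !(ipE hip) /=.
rewrite !(ipC hip v u) !(ipC hip w) uv.
have LvuE : ip (L v) u = ip u (L v) by rewrite (ipC hip).
have LuvE : ip (L u) v = ip u (L v) by rewrite hL.
have vLuE : ip v (L u) = ip u (L v) by rewrite (ipC hip).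
rewrite !(hL (L _)) !(ipC hip (L u) (L v)) LvuE LuvE vLuE.
ring.
Qed.

(** Both sides of [weyl_sectional_iota] scale in the same way, so orthonormal
pairs control orthogonal pairs of any length; degenerate pairs give 0. *)
Lemma weyl_form_nonpos_of_weyl E : weyl_nonpositive g nabla (iota E) ->
  weyl_form_nonpos ip L E.1 E.2.
Proof.
move=> hK a u v uv.
have [v0|v0] := eqVneq v 0.
  by rewrite v0 /weyl_form linear0 !(ipE hip); nra.
pose x : ext t := (a, u); pose N := ext_ip ip x x.
have [[-> ->]|x0] := eqVneq x 0.
  by rewrite /weyl_form linear0 !(ipE hip); nra.
have N0 : 0 < N by exact: ip_gt0 hB x x0.
have V0 : 0 < ip v v by exact: ip_gt0 hip v v0.
pose r := (Num.sqrt N)^-1; pose s := (Num.sqrt (ip v v))^-1.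
have r2 : r ^+ 2 * N = 1.
  by rewrite exprVn sqr_sqrtr ?mulVf ?gt_eqF // ltW.
have s2 : s ^+ 2 * ip v v = 1.
  by rewrite exprVn sqr_sqrtr ?mulVf ?gt_eqF // ltW.
have := hK (lg_one S) (iota (r *: x)) (iota (0, s *: v))
  (iota_smooth _) (iota_smooth _).
rewrite !inner_iota.
have ruv : ip (r *: x).2 (s *: v) = 0 by rewrite /= !(ipE hip) uv; ring.
rewrite (weyl_sectional_iota _ _ ruv).
rewrite !(ipZl hB) !(ipZr hB) -/N mulrA -expr2 r2.
have -> : ext_ip ip (0, s *: v) (0, s *: v) = 1.
  by rewrite /ext_ip /= !(ipE hip) -s2; ring.
have -> : ext_ip ip x (0, s *: v) = 0.
  by rewrite /ext_ip /= !(ipE hip) uv; ring.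
rewrite mulr0 => /(_ erefl erefl erefl).
have -> : weyl_form ip L E.1 E.2 (r *: x).1 (r *: x).2 (s *: v)
   = r ^+ 2 * s ^+ 2 * weyl_form ip L E.1 E.2 a u v.
  by rewrite /weyl_form /= !regular_scaleE !lfunE_ops !(ipE hip); ring.
rewrite pmulr_rle0 // mulr_gt0 // exprn_gt0 // invr_gt0 sqrtr_gt0 //.
Qed.

End LeftInvariantFields.

(** * The classification of non-positive Weyl connections *)

Theorem theorem5p3 (R : realType) (n : nat) (hn : (2 <= n)%N)
  (t : vectType R) (ht : (\dim {:t} = n)%N)
  (ip : t -> t -> R) (hip : scalar_product ip)
  (L : 'End(t)) (hL : forall u v : t, ip (L u) v = ip u (L v))
  (* eigenvalues mu 1 <= ... <= mu n and basis e 0 = b, e 1, ..., e n *)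
  (mu : nat -> R) (e : nat -> ext t)
  (hmu_le : forall i j : nat, (1 <= i)%N -> (i <= j)%N -> (j <= n)%N -> mu i <= mu j)
  (hmu_neq0 : forall i : nat, (1 <= i <= n)%N -> mu i != 0)
  (he_basis : basis_of {:ext t} (mkseq e n.+1))
  (he_orth : forall i j : nat, (i <= n)%N -> (j <= n)%N ->
     ext_ip ip (e i) (e j) = (i == j)%:R)
  (he0 : e 0%N = ext_b t)
  (heL : forall i : nat, (1 <= i <= n)%N ->
     (e i).1 = 0 /\ L (e i).2 = mu i *: (e i).2)
  (* a Lie group S with this Lie algebra and its left invariant metric *)
  (S : lie_group R n.+1) (iota : ext t -> vfield S)
  (hS : lie_algebra_of (ext_bracket L) iota)
  (g : S -> 'rV[R]_n.+1 -> 'rV[R]_n.+1 -> R) (hg : riemannian_metric g)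
  (hg_inv : forall (x y : ext t) (p : S), g p (iota x p) (iota y p) = ext_ip ip x y)
  (nabla : vfield S -> vfield S -> vfield S) (hnabla : levi_civita g nabla)
  (alpha : nat -> R) (E : ext t)
  (hE : E = \sum_(0 <= i < n.+1) alpha i *: e i)
  (hnonpos : weyl_nonpositive g nabla (iota E)) :
  [/\ ~ (mu 1%N < alpha 0%N /\ alpha 0%N < mu n),
      0 < mu n -> mu n <= alpha 0%N ->
        (forall i : nat, (1 <= i <= n)%N -> 0 < mu i -> mu i = mu n) /\
        E = mu n *: e 0%N &
      mu 1%N < 0 -> alpha 0%N <= mu 1%N ->
        (forall i : nat, (1 <= i <= n)%N -> mu i < 0 -> mu i = mu 1%N) /\
        E = mu 1%N *: e 0%N].
Proof.
pose f i := (e i).2.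
have hK := weyl_form_nonpos_of_weyl hip hL ht hS hg hg_inv hnabla hnonpos.
have f_orth i j : (1 <= i <= n)%N -> (1 <= j <= n)%N ->
    ip (f i) (f j) = (i == j)%:R.
  move=> hi hj; rewrite -he_orth; [|by case/andP: hi|by case/andP: hj].
  by rewrite /ext_ip (heL _ hi).1 mul0r add0r.
have Lf i : (1 <= i <= n)%N -> L (f i) = mu i *: f i by move=> /heL[].
have f_total u : (forall i, (1 <= i <= n)%N -> ip u (f i) = 0) -> u = 0.
  move=> uf; pose x : ext t := (0, u).
  have hB := ext_ip_scalar_product hip.
  have : x \in <<mkseq e n.+1>>%VS by rewrite (span_basis he_basis) memvf.
  move=> /(@coord_span _ _ _ (in_tuple (mkseq e n.+1))).
  set c := coord _ => xE.
  have : ext_ip ip x x = 0.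
    rewrite {1}xE (ip_suml hB) big1 // => i _.
    have lti : (i < n.+1)%N
      by apply: leq_trans (ltn_ord i) _; rewrite size_mkseq.
    rewrite (ipZl hB) nth_mkseq // /ext_ip mulr0 add0r (ipC hip).
    have [->|i0] := posnP i; first by rewrite he0 /= (ip0r hip) mulr0.
    by rewrite uf ?mulr0 // i0.
  by move/eqP; rewrite (ip_eq0 hB) => /eqP[].
have a0 : E.1 = alpha 0%N.
  rewrite hE big_nat_recl // he0 big_nat.
  have -> (w : ext t) : (alpha 0%N *: ext_b t + w).1 = alpha 0%N + w.1.
    by rewrite /= regular_scaleE mulr1.
  rewrite (big_morph (fun x : ext t => x.1) (id1 := 0) (op1 := +%R)) //.
  by rewrite big1 ?addr0 // => i hi; rewrite /= (heL i.+1 _).1 // scaler0.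
have n0 : (1 <= n)%N by exact: ltnW.
have h1 : (1 <= 1 <= n)%N by rewrite n0.
have hnn : (1 <= n <= n)%N by rewrite n0 leqnn.
have unit i : (1 <= i <= n)%N -> ip (f i) (f i) = 1.
  by move=> hi; rewrite f_orth // eqxx.
have ne1n : (1%N == n) = false by rewrite ltn_eqF.
have f1n : ip (f 1%N) (f n) = 0 by rewrite f_orth // ne1n.
have fn1 : ip (f n) (f 1%N) = 0 by rewrite (ipC hip).
have Ee0 m : E.1 = m -> E.2 = 0 -> E = m *: e 0%N.
  move=> E1 E2; rewrite he0 [E]surjective_pairing E1 E2.
  by congr pair => /=; rewrite ?regular_scaleE ?mulr1 ?scaler0.
rewrite -a0; split.
- move=> [h h'].
  apply: (between_eigenvalues_false hip hL hK _ (unit _ h1) (unit _ hnn) f1n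
            (Lf _ h1) (Lf _ hnn) h h').
  move=> u Lu; apply: f_total => i hi.
  apply: (mulfI (hmu_neq0 _ hi)).
  by rewrite -(ipZr hip) -Lf // -hL Lu (ip0l hip) mulr0.
- move=> mun0 mun.
  have top := rayleigh_le hip f_orth f_total hL Lf
    (fun i hi => hmu_le i n (proj1 (andP hi)) (proj2 (andP hi)) (leqnn n)).
  have [am w0 pos] := ge_top_eigenvalue hip hL hK (unit _ hnn) (unit _ h1) fn1
     (Lf _ hnn) top mun0 mun.
  by split; [move=> i hi; exact: (pos _ (f i) (unit _ hi) (Lf _ hi))|exact: Ee0].
- move=> mu10 mu1.
  have hLN u v : ip ((- L)%R u) v = ip u ((- L)%R v).
    by rewrite !opp_lfunE !(ipE hip) hL.
  have LfN i : (1 <= i <= n)%N -> (- L)%R (f i) = (- mu i) *: f i.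
    by move=> hi; rewrite opp_lfunE Lf // scaleNr.
  have muN i : (1 <= i <= n)%N -> - mu i <= - mu 1%N.
    by move=> /andP[i1 i_n]; rewrite lerN2 hmu_le.
  have top := rayleigh_le hip f_orth f_total hLN LfN muN.
  have [] := ge_top_eigenvalue hip hLN (weyl_form_nonposN hip hK) (unit _ h1)
     (unit _ hnn) f1n (LfN _ h1) top.
  + by rewrite oppr_gt0.
  + by rewrite lerN2.
  move=> am w0 pos; split; last by apply: Ee0 => //; exact: oppr_inj.
  move=> i hi mui; apply: oppr_inj.
  by apply: (pos _ (f i) (unit _ hi) (LfN _ hi)); rewrite oppr_gt0.
Qed.
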